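(* Let $(\Psi,\mathbf{Q},\leq)$ be a proper costratifying system of size $t$ in $\mathrm{mod}(\Lambda)$, where $\Lambda$ is an artin algebra, $\Psi=\{\Psi(i)\}_{i=1}^t$, $\mathbf{Q}=\{Q(i)\}_{i=1}^t$ and $Q=\bigoplus_{i=1}^tQ(i)$. Then for each $i\in[1,t]$ and each $M\in\mathcal F(\{\Psi(j):j\leq i\})$ there exists an exact sequence $0\to M'\to Q'\to M\to0$ in $\mathcal F(\{\Psi(j):j\leq i\})$ with $Q'\in\mathrm{add}(\bigoplus_{j\leq i}Q(j))$. In particular $\mathcal F(\Psi)\subseteq C^Q_m$ for all $m\geq1$.
   Context: $R$ is a commutative artinian ring, algebras are artin $R$-algebras, and ''module'' means finitely generated left module. $[1,t]=\{1,\dots,t\}$. $\mathrm{add}(M)$ is the full subcategory of finite direct sums of direct summands of $M$. For a class $\mathcal C$ of modules, $\mathcal F(\mathcal C)$ is the class of modules $M$ having a finite filtration $0=M_0\subseteq\cdots\subseteq M_s=M$ with every factor isomorphic to a module in $\mathcal C$. A proper costratifying system $(\Psi,\mathbf{Q},\leq)$ of size $t$ in $\mathrm{mod}(\Lambda)$ consists of families of $\Lambda$-modules $\Psi=\{\Psi(i)\}_{i=1}^t$ and $\mathbf{Q}=\{Q(i)\}_{i=1}^t$, each $Q(i)$ indecomposable, and a linear order $\leq$ on $[1,t]$ such that: (1) $\mathrm{End}_\Lambda(\Psi(i))$ is a division ring for all $i$; (2) $\mathrm{Hom}_\Lambda(\Psi(i),\Psi(j))=0$ if $i<j$; (3) for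 each $i$ there is an exact sequence $0\to Z(i)\to Q(i)\xrightarrow{\beta_i}\Psi(i)\to0$ with $Z(i)\in\mathcal F(\{\Psi(j):j\leq i\})$; (4) $\mathrm{Ext}^1_\Lambda(Q(i),\Psi(j))=0$ for all $i,j\in[1,t]$. For a $\Lambda$-module $M$ and $m\geq0$, $C^M_m$ is the full subcategory of $\mathrm{mod}(\Lambda)$ of modules $X$ admitting an exact sequence $M_m\to M_{m-1}\to\cdots\to M_0\to X\to0$ with all $M_i\in\mathrm{add}(M)$ which remains exact after applying $\mathrm{Hom}_\Lambda(M,-)$, i.e. $\mathrm{Hom}_\Lambda(M,M_m)\to\cdots\to\mathrm{Hom}_\Lambda(M,M_0)\to\mathrm{Hom}_\Lambda(M,X)\to0$ is exact. *)

(* Defs.v *)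
(* Modules are left modules [lmodType A], morphisms are [{linear U -> V}].
   Submodules are the library's boolean-valued [submodClosed] predicates; under
   classical logic with choice, every submodule is given by such a predicate
   and every module carries a [choiceType] structure. *)
From HB Require Import structures.
From mathcomp Require Import all_boot all_order all_algebra.

Set Implicit Arguments.
Unset Strict Implicit.
Unset Printing Implicit Defensive.

Import GRing.Theory.
Local Open Scope ring_scope.
Local Open Scope quotient_scope.

Section Submodule.
Variables (A : pzRingType) (V : lmodType A) (S : submodClosed V).

Definition submodule : Type := {x : V | x \in S}.
HB.instance Definition _ := SubChoice.on submodule.
HB.instance Definition _ := [SubChoice_isSubLmodule of submodule by <:].

(* [submodClosed V] does not inherit from [zmodClosed V], which the library's
   [Quotient.quot] expects, so the predicate is repackaged. *)
Definition zmod_pred : {pred V} := fun x => x \in S.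

Lemma zmod_pred_closed : zmod_closed zmod_pred.
Proof. exact: (GRing.submod_closedB (GRing.submodClosedP S)). Qed.
HB.instance Definition _ := GRing.isZmodClosed.Build V zmod_pred zmod_pred_closed.

Definition quotmod : Type := Quotient.quot zmod_pred.
HB.instance Definition _ := Choice.on quotmod.
HB.instance Definition _ := ZmodQuotient.on quotmod.

Definition quot_scale (a : A) (x : quotmod) : quotmod :=
  \pi_quotmod (a *: repr x).

Lemma quot_scale_pi a (v : V) :
  quot_scale a (\pi_quotmod v) = \pi_quotmod (a *: v).
Proof.
apply/eqP; rewrite -Quotient.idealrBE -scalerBr; apply: (@rpredZ _ _ S).
by have /eqP := reprK (\pi_quotmod v); rewrite -Quotient.idealrBE.
Qed.

Lemma quot_scaleA a b x :
  quot_scale a (quot_scale b x) = quot_scale (a * b) x.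
Proof. by rewrite {2}/quot_scale quot_scale_pi scalerA. Qed.

Lemma quot_scale1 : left_id 1 quot_scale.
Proof. by move=> x; rewrite /quot_scale scale1r reprK. Qed.

Lemma quot_scaleDr : right_distributive quot_scale +%R.
Proof.
move=> a x y.
rewrite -[x]reprK -[y]reprK.
by rewrite -raddfD !quot_scale_pi scalerDr raddfD.
Qed.

Lemma quot_scaleDl x : {morph quot_scale^~ x : a b / a + b}.
Proof. by move=> a b; rewrite /quot_scale scalerDl raddfD. Qed.

HB.instance Definition _ := GRing.Zmodule_isLmodule.Build A quotmod
  quot_scaleA quot_scale1 quot_scaleDr quot_scaleDl.

End Submodule.

Section Factor.
Variables (A : pzRingType) (V : lmodType A) (N L : submodClosed V).

Definition submodule_pred : {pred submodule L} := fun x => \val x \in N.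

Lemma submodule_pred_closed : subsemimod_closed submodule_pred.
Proof.
have E x : (x \in submodule_pred) = (\val x \in N) by [].
split; [split|]; rewrite ?E ?raddf0 ?rpred0 //.
- by move=> x y; rewrite !E raddfD; exact: rpredD.
- by move=> a x; rewrite !E linearZ; exact: rpredZ.
Qed.
HB.instance Definition _ := GRing.isSubmodClosed.Build A (submodule L)
  submodule_pred submodule_pred_closed.

(* L / (N :&: L), that is L / N when N is contained in L. *)
Definition factor : lmodType A := quotmod submodule_pred.

End Factor.

Section DirectSum.
Variables (A : pzRingType) (I : finType) (M : I -> lmodType A).

Definition dsum : Type := {dffun forall i : I, M i}.
HB.instance Definition _ := Choice.on dsum.

Implicit Types f g h : dsum.
Definition dsum_zero : dsum := [ffun i => 0 : M i].
Definition dsum_opp f : dsum := [ffun i => - f i : M i].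
Definition dsum_add f g : dsum := [ffun i => f i + g i : M i].
Definition dsum_scale (a : A) f : dsum := [ffun i => a *: f i : M i].

Lemma dsum_addA : associative dsum_add.
Proof. by move=> f g h; apply/ffunP => i; rewrite !ffunE addrA. Qed.
Lemma dsum_addC : commutative dsum_add.
Proof. by move=> f g; apply/ffunP => i; rewrite !ffunE addrC. Qed.
Lemma dsum_add0 : left_id dsum_zero dsum_add.
Proof. by move=> f; apply/ffunP => i; rewrite !ffunE add0r. Qed.
Lemma dsum_addN : left_inverse dsum_zero dsum_opp dsum_add.
Proof. by move=> f; apply/ffunP => i; rewrite !ffunE addNr. Qed.
HB.instance Definition _ :=
  GRing.isZmodule.Build dsum dsum_addA dsum_addC dsum_add0 dsum_addN.

Lemma dsum_scaleA a b f : dsum_scale a (dsum_scale b f) = dsum_scale (a * b) f.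
Proof. by apply/ffunP => i; rewrite !ffunE scalerA. Qed.
Lemma dsum_scale1 : left_id 1 dsum_scale.
Proof. by move=> f; apply/ffunP => i; rewrite !ffunE scale1r. Qed.
Lemma dsum_scaleDr : right_distributive dsum_scale +%R.
Proof. by move=> a f g; apply/ffunP => i; rewrite !ffunE scalerDr. Qed.
Lemma dsum_scaleDl f : {morph dsum_scale^~ f : a b / a + b}.
Proof. by move=> a b; apply/ffunP => i; rewrite !ffunE scalerDl. Qed.
HB.instance Definition _ := GRing.Zmodule_isLmodule.Build A dsum
  dsum_scaleA dsum_scale1 dsum_scaleDr dsum_scaleDl.

End DirectSum.

Section Modules.
Variable A : pzRingType.
Implicit Types U V W M X Y : lmodType A.

Definition fin_gen M : Prop :=
  exists (n : nat) (x : 'I_n -> M),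
    forall y : M, exists c : 'I_n -> A, y = \sum_i c i *: x i.

Definition isomorphic U V : Prop := exists f : {linear U -> V}, bijective f.

Definition zero_module M : Prop := forall x : M, x = 0.

Definition indecomposable M : Prop :=
  ~ zero_module M /\
  forall U V, isomorphic M (U * V)%type -> zero_module U \/ zero_module V.

Definition surjective U V (f : U -> V) : Prop := forall y, exists x, f x = y.

Definition exact_at U V W (f : U -> V) (g : V -> W) : Prop :=
  forall y, g y = 0 <-> exists x, f x = y.

Definition short_exact U V W (f : U -> V) (g : V -> W) : Prop :=
  [/\ injective f, exact_at f g & surjective g].

Definition Hom_zero U V : Prop := forall (f : {linear U -> V}) x, f x = 0.

(* The first conjunct says that 1 != 0 in End(M). *)
Definition End_division_ring M : Prop :=
  ~ zero_module M /\
  forall f : {linear M -> M}, ~ (forall x, f x = 0) ->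
    exists g : {linear M -> M}, cancel f g /\ cancel g f.

(* Elements of Yoneda's Ext^1(X, Y) are the classes of extensions
   0 -> Y -> E -> X -> 0 under [ext_equiv]; the zero element is the class of
   the split extension. *)
Record extension X Y := Extension {
  ext_mod : lmodType A;
  ext_inj : {linear Y -> ext_mod};
  ext_proj : {linear ext_mod -> X};
  ext_exact : short_exact ext_inj ext_proj
}.

Definition ext_equiv X Y (e e' : extension X Y) : Prop :=
  exists f : {linear ext_mod e -> ext_mod e'},
    [/\ bijective f, forall y, f (ext_inj e y) = ext_inj e' y
      & forall z, ext_proj e' (f z) = ext_proj e z].

Section Split.
Variables X Y : lmodType A.

Definition split_inj (y : Y) : Y * X := (y, 0).
Definition split_proj (z : Y * X) : X := z.2.

Lemma split_inj_linear : linear split_inj.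
Proof. by move=> a u v; congr pair; rewrite /= scaler0 addr0. Qed.
HB.instance Definition _ :=
  GRing.isLinear.Build A Y (Y * X)%type _ split_inj split_inj_linear.

Lemma split_proj_linear : linear split_proj.
Proof. by []. Qed.
HB.instance Definition _ :=
  GRing.isLinear.Build A (Y * X)%type X _ split_proj split_proj_linear.

Lemma split_exact : short_exact split_inj split_proj.
Proof.
split; first by move=> u v [].
- move=> [y x]; rewrite /split_proj /=; split=> [->|[u [_ <-]]] //.
  by exists y.
- by move=> x; exists (0, x).
Qed.

Definition split_ext : extension X Y :=
  @Extension X Y (Y * X)%type split_inj split_proj split_exact.

End Split.

Definition Ext1_zero X Y : Prop :=
  forall e : extension X Y, ext_equiv e (split_ext X Y).

Definition direct_summand U M : Prop := exists V, isomorphic M (U * V)%type.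

Definition in_add M X : Prop :=
  fin_gen X /\
  exists (n : nat) (Y : 'I_n -> lmodType A),
    (forall k, direct_summand (Y k) M) /\ isomorphic X (dsum Y).

(* M is in F({Psi j | P j}). *)
Definition filtered (I : Type) (P : pred I) (Psi : I -> lmodType A) M : Prop :=
  fin_gen M /\
  exists (s : nat) (F : nat -> submodClosed M),
    [/\ forall x, x \in F 0%N <-> x = 0,
        forall x, x \in F s
      & forall k, (k < s)%N -> {subset F k <= F k.+1} /\
          exists2 j, P j & isomorphic (factor (F k) (F k.+1)) (Psi j)].

Definition Hom_surjective M V W (g : {linear V -> W}) : Prop :=
  forall h : {linear M -> W}, exists h' : {linear M -> V},
    forall x, g (h' x) = h x.

Definition Hom_exact_at M U V W (f : {linear U -> V}) (g : {linear V -> W}) :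
    Prop :=
  forall h : {linear M -> V},
    (forall x, g (h x) = 0) <->
    exists h' : {linear M -> U}, forall x, f (h' x) = h x.

(* X is in C^M_m: only N 0, ..., N m and d 0, ..., d m.-1 are constrained,
   and there is no exactness requirement at N m. *)
Definition in_C M (m : nat) X : Prop :=
  fin_gen X /\
  exists (N : nat -> lmodType A) (d : forall k, {linear N k.+1 -> N k})
         (eps : {linear N 0%N -> X}),
    [/\ forall k, (k <= m)%N -> in_add M (N k),
        surjective eps /\ Hom_surjective M eps,
        (0 < m)%N -> exact_at (d 0%N) eps /\ Hom_exact_at M (d 0%N) eps
      & forall k, (k.+1 < m)%N ->
          exact_at (d k.+1) (d k) /\ Hom_exact_at M (d k.+1) (d k)].

Definition linear_order (T : eqType) (le : rel T) : Prop :=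
  [/\ reflexive le, antisymmetric le, transitive le & total le].

(* The index set [1,t] is represented by 'I_t. *)
Record proper_costratifying_system (t : nat) (Psi Q : 'I_t -> lmodType A)
    (le : rel 'I_t) : Prop := ProperCostratifyingSystem {
  pcs_order : linear_order le;
  pcs_Psi_fg : forall i, fin_gen (Psi i);
  pcs_Q_fg : forall i, fin_gen (Q i);
  pcs_Q_indec : forall i, indecomposable (Q i);
  pcs_End : forall i, End_division_ring (Psi i);
  pcs_Hom : forall i j, le i j -> i != j -> Hom_zero (Psi i) (Psi j);
  pcs_seq : forall i, exists (Z : lmodType A)
      (a : {linear Z -> Q i}) (beta : {linear Q i -> Psi i}),
      short_exact a beta /\ filtered (fun j => le j i) Psi Z;
  pcs_Ext : forall i j, Ext1_zero (Q i) (Psi j)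
}.

End Modules.

(* Ideals of the commutative ring R are the submodules of R^o. *)
Definition artinian_ring (R : comPzRingType) : Prop :=
  forall N : nat -> submodClosed R^o,
    (forall k, {subset N k.+1 <= N k}) ->
    exists n, forall k, (n <= k)%N -> N k =i N n.

Definition artin_algebra (R : comPzRingType) (L : algType R) : Prop :=
  artinian_ring R /\ fin_gen (L : lmodType R).

(* Main.v *)
Require Import Defs.
From HB Require Import structures.
From mathcomp Require Import all_boot all_order all_algebra.
From mathcomp Require Import boolp.

(* Everything rests on [Ext^1(Q i, N) = 0] for [N] in F(Psi), which follows by
   devissage along a filtration of [N].  Given 0 -> N -> M -> Psi j -> 0 and a
   cover QN -> N with kernel N', lift beta_j : Q j -> Psi j to M.  The map
   QN + Q j -> M is then surjective, and its kernel is an extension of Z j by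
   N', hence filtered; induction on the filtration gives the covers.
   By the same vanishing, Hom(Q, -) is exact on 0 -> M' -> Q' -> M -> 0, so
   iterating the covers on the kernels M' produces the resolution of M. *)

Set Implicit Arguments.
Unset Strict Implicit.
Unset Printing Implicit Defensive.

Import GRing.Theory.
Local Open Scope ring_scope.

(** * Building, factoring and inverting linear maps *)

Section Linear.
Variable A : pzRingType.
Implicit Types U V W X : lmodType A.

Lemma linear_exists U V (f : U -> V) :
  linear f -> exists h : {linear U -> V}, h =1 f.
Proof.
move=> lf; pose m := GRing.isLinear.Build A U V *:%R f lf.
pose h : {linear U -> V} := HB.pack f m.
by exists h.
Qed.

Lemma linear_inj0 U V (f : {linear U -> V}) :
  (forall x, f x = 0 -> x = 0) -> injective f.
Proof.
move=> f0 x y E; apply/eqP; rewrite -subr_eq0; apply/eqP/f0.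
by apply/eqP; rewrite linearB subr_eq0 E.
Qed.

Lemma inj_surj_bijective U V (f : U -> V) :
  injective f -> surjective f -> bijective f.
Proof.
by move=> fI /choice[g gE]; exists g => [x|//]; apply: fI; rewrite gE.
Qed.

Lemma bijective_surjective U V (f : U -> V) : bijective f -> surjective f.
Proof. by case=> g _ gK y; exists (g y). Qed.

(** Preimages under an injective map are unique, so the ones picked by choice depend linearly on
    [w]. With [h] the identity this inverts a bijective [f]. *)
Lemma factor_mono U V W (f : {linear U -> V}) (h : {linear W -> V}) :
  injective f -> (forall w, exists u, f u = h w) ->
  exists k : {linear W -> U}, forall w, f (k w) = h w.
Proof.
move=> fI /choice[k kE].
have [|k' k'E] := @linear_exists W U k.
  by move=> a u v; apply: fI; rewrite linearP !kE linearP.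
by exists k' => w; rewrite k'E.
Qed.

(** [h] is constant on the fibres of [p], so its composite with a set-theoretic section of [p] does
    not depend on the section and is linear. *)
Lemma factor_epi U V W (p : {linear U -> V}) (h : {linear U -> W}) :
  surjective p -> (forall x, p x = 0 -> h x = 0) ->
  exists k : {linear V -> W}, forall x, k (p x) = h x.
Proof.
move=> /choice[s sE] ph.
have hE x y : p x = p y -> h x = h y.
  move=> E; apply/eqP; rewrite -subr_eq0 -linearB; apply/eqP/ph.
  by apply/eqP; rewrite linearB subr_eq0 E.
have [|k kE] := @linear_exists V W (h \o s).
  by move=> a u v /=; rewrite -linearP; apply: hE; rewrite linearP !sE.
by exists k => x; rewrite kE; apply: hE.
Qed.

Lemma isomorphic_sym U V : isomorphic U V -> isomorphic V U.
Proof.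
case=> f fB; have fS := bijective_surjective fB.
have [k kE] := factor_mono (h := idfun) (bij_inj fB) fS.
exists k; exists f => x; first exact: kE.
by apply: (bij_inj fB); rewrite kE.
Qed.

Lemma isomorphic_trans U V W :
  isomorphic U V -> isomorphic V W -> isomorphic U W.
Proof. by case=> f fB [g gB]; exists (g \o f); apply: bij_comp. Qed.

Lemma isomorphic_prod U U' V :
  isomorphic U U' -> isomorphic (U * V)%type (U' * V)%type.
Proof.
case=> f [g fK gK].
have [|h hE] := @linear_exists (U * V)%type (U' * V)%type
  (fun z => (f z.1, z.2)).
  by move=> a u v; congr pair; rewrite /= linearP.
exists h; exists (fun z => (g z.1, z.2)) => [] [u v]; rewrite ?hE /=.
  by rewrite fK.
by rewrite gK.
Qed.

Lemma exact0 U V W (f : U -> V) (g : V -> W) :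
  exact_at f g -> forall x, g (f x) = 0.
Proof. by move=> fg x; apply/fg; exists x. Qed.

Lemma short_exact_iso U V W W' (f : U -> V) (g : {linear V -> W})
    (h : {linear W -> W'}) :
  bijective h -> short_exact f g -> short_exact f (h \o g).
Proof.
move=> hB [fI fg gS]; split=> // [y|w].
  rewrite -fg /=; split=> [|->]; last by rewrite linear0.
  by move=> E; apply: (bij_inj hB); rewrite E linear0.
by have [v <-] := bijective_surjective hB w; have [x <-] := gS v; exists x.
Qed.

End Linear.

(** * Kernels and images as submodules *)

Section Submodules.
Variables (A : pzRingType) (U V : lmodType A) (f : {linear U -> V}).

Definition kermod : {pred U} := fun x => f x == 0.
Lemma kermod_closed : subsemimod_closed kermod.
Proof.
have E x : (x \in kermod) = (f x == 0) by [].
split; [split|]; rewrite ?E ?linear0 //.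
- by move=> x y; rewrite !E linearD => /eqP-> /eqP->; rewrite addr0.
- by move=> a x; rewrite !E linearZ_LR => /eqP->; rewrite scaler0.
Qed.
HB.instance Definition _ := GRing.isSubmodClosed.Build A U kermod kermod_closed.

Section Image.
Variable S : submodClosed U.
Definition immod : {pred V} := fun y => `[< exists2 x, x \in S & f x = y >].
Lemma immodP y : reflect (exists2 x, x \in S & f x = y) (y \in immod).
Proof. exact: asboolP. Qed.
Lemma immod_closed : subsemimod_closed immod.
Proof.
split; [split|].
- by apply/immodP; exists 0; rewrite ?rpred0 ?linear0.
- move=> _ _ /immodP[x xS <-] /immodP[y yS <-].
  by apply/immodP; exists (x + y); rewrite ?linearD ?rpredD.
- move=> a _ /immodP[x xS <-].
  by apply/immodP; exists (a *: x); rewrite ?linearZ_LR ?rpredZ.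
Qed.
HB.instance Definition _ := GRing.isSubmodClosed.Build A V immod immod_closed.
End Image.

End Submodules.

(** Encoded as the kernel of the zero map, so that closure is inherited from [kermod]. *)
Definition fullmod (A : pzRingType) (V : lmodType A) : submodClosed V :=
  kermod (\0 : {linear V -> V}).

Lemma in_fullmod (A : pzRingType) (V : lmodType A) (x : V) : x \in fullmod V.
Proof. exact: eqxx. Qed.

(** * Quotients, short exact sequences and finite generation *)

Section Exact.
Variable A : pzRingType.
Implicit Types U V W X : lmodType A.

Lemma kermod_short_exact V W (g : {linear V -> W}) : surjective g ->
  short_exact (val : submodule (kermod g) -> V) g.
Proof.
move=> gS; split=> // [|y]; first exact: val_inj.
split=> [/eqP gy|[[x /= /eqP gx] <-]] //.
by exists (Sub y gy : submodule (kermod g)).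
Qed.

Definition quotmod_pi V (S : submodClosed V) (x : V) : quotmod S :=
  (\pi_(quotmod S) x)%qT.

Lemma quotmod_pi_linear V (S : submodClosed V) : linear (@quotmod_pi V S).
Proof.
move=> a u v; rewrite /quotmod_pi raddfD; congr (_ + _).
exact/esym/quot_scale_pi.
Qed.
HB.instance Definition _ V (S : submodClosed V) :=
  GRing.isLinear.Build A V (quotmod S) _ (@quotmod_pi V S)
    (quotmod_pi_linear S).

Lemma quotmod_pi_eq0 V (S : submodClosed V) x :
  quotmod_pi S x = 0 <-> x \in S.
Proof.
rewrite -(linear0 (quotmod_pi S)) /quotmod_pi; split=> [/eqP|xS].
  by rewrite -Quotient.idealrBE subr0.
by apply/eqP; rewrite -Quotient.idealrBE subr0.
Qed.

Lemma quotmod_pi_surj V (S : submodClosed V) : surjective (quotmod_pi S).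
Proof. by move=> y; exists (repr y); rewrite /quotmod_pi reprK. Qed.

(** The first isomorphism theorem, used to identify the factors of a filtration. *)
Lemma quotmod_isomorphic V W (S : submodClosed V) (g : {linear V -> W}) :
  surjective g -> (forall x, g x = 0 <-> x \in S) -> isomorphic (quotmod S) W.
Proof.
move=> gS gE.
have [|k kE] := factor_epi (h := g) (quotmod_pi_surj (S := S)).
  by move=> x /quotmod_pi_eq0/gE.
exists k; apply: inj_surj_bijective.
  apply: linear_inj0 => y; have [x <-] := quotmod_pi_surj y.
  by rewrite kE => /gE/quotmod_pi_eq0.
by move=> w; have [x <-] := gS w; exists (quotmod_pi S x); rewrite kE.
Qed.

Lemma fin_gen0 V : zero_module V -> fin_gen V.
Proof.
by move=> V0; exists 0%N, (fun=> 0) => y; exists (fun=> 0); rewrite big_ord0.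
Qed.

(** Images of generators of [U] together with lifts of generators of [W] generate [V]: subtracting a
    combination of the lifts from [v] leaves an element of the image of [f]. *)
Lemma fin_gen_ext U V W (f : {linear U -> V}) (g : {linear V -> W}) :
  short_exact f g -> fin_gen U -> fin_gen W -> fin_gen V.
Proof.
move=> [_ fg gS] [n [x xE]] [m [y yE]].
have [z zE] := fin_all_exists (fun j => gS (y j)).
exists (n + m)%N,
  (fun k => match split k with inl i => f (x i) | inr j => z j end) => v.
have [d dE] := yE (g v).
have [|u uE] := (fg (v - \sum_j d j *: z j)).1.
  apply/eqP; rewrite linearB subr_eq0 dE linear_sum; apply/eqP.
  by apply: eq_bigr => j _; rewrite linearZ_LR zE.
have [c cE] := xE u.
exists (fun k => match split k with inl i => c i | inr j => d j end).
rewrite big_split_ord /= -[LHS](subrK (\sum_j d j *: z j)) -uE cE linear_sum.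
congr (_ + _); apply: eq_bigr => k _.
  by rewrite linearZ_LR -[lshift m k]/(unsplit (inl k)) unsplitK.
by rewrite -[rshift n k]/(unsplit (inr k)) unsplitK.
Qed.

End Exact.

(** * Filtered modules as iterated extensions *)

Section Filt.
Variables (A : pzRingType) (I : Type) (P : pred I) (Psi : I -> lmodType A).

(** F({Psi j | P j}) with filtrations peeled off from the top: [N] is the penultimate term.
    Induction on this predicate is devissage, with no chain of submodules to carry along. *)
Inductive filt : lmodType A -> Prop :=
| FiltZero (M : lmodType A) : zero_module M -> filt M
| FiltStep (N M : lmodType A) (j : I) (f : {linear N -> M})
    (g : {linear M -> Psi j}) :
    P j -> filt N -> short_exact f g -> filt M.

(** Only the last extension has to be transported; the smaller module [N] stays the same, so a case
    analysis is enough. *)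
Lemma filt_iso M M' : isomorphic M M' -> filt M -> filt M'.
Proof.
move=> isoM fM; case: fM isoM => {M} [M M0|N M j f g Pj fN [fI fg gS]] [h hB].
  apply: FiltZero => x.
  by have [y <-] := bijective_surjective hB x; rewrite (M0 y) linear0.
have [h' hK h'K] := hB.
have hI := can_inj hK.
have [k kE] := factor_mono (h := idfun) hI (fun w => ex_intro _ (h' w) (h'K w)).
apply: (FiltStep (j := j) (N := N) (f := h \o f) (g := g \o k)) => //.
split=> [|y|y].
- exact: inj_comp.
- split=> /= [/fg[x xE]|[x <-]]; first by exists x; rewrite xE kE.
  suff -> : k (h (f x)) = f x by exact: exact0.
  by apply: hI; rewrite kE.
- have [x <-] := gS y; exists (h x) => /=; congr (g _).
  by apply: hI; rewrite kE.
Qed.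

(** By induction on [k], each term [F k], seen as a module, is an iterated extension; the term [F s]
    is all of [M]. *)
Lemma filtered_filt M : filtered P Psi M -> filt M.
Proof.
case=> _ [s [F [F0 Fs FS]]].
suff fF k : (k <= s)%N -> filt (submodule (F k)).
  apply: filt_iso (fF s (leqnn s)); exists val.
  by apply: inj_surj_bijective val_inj _ => y; exists (Sub y (Fs y)).
elim: k => [_|k IH ks].
  by apply: FiltZero => x; apply/val_inj/F0/valP.
have [sub [j Pj [h hB]]] := FS k ks.
have [|i iE] := factor_mono (f := val : {linear submodule (F k.+1) -> M})
  (h := val : {linear submodule (F k) -> M}) val_inj.
  by move=> w; exists (Sub (val w) (sub _ (valP w))).
apply: (FiltStep (f := i) Pj (IH (ltnW ks))).
apply: (short_exact_iso (g := quotmod_pi _) hB); split.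
- by move=> x y /(congr1 val); rewrite !iE => /val_inj.
- move=> y; rewrite quotmod_pi_eq0; split=> [yN|[x <-]].
    by exists (Sub (val y) yN); apply: val_inj; rewrite iE.
  by rewrite unfold_in iE; apply: valP.
- exact: quotmod_pi_surj.
Qed.

Lemma filt_fin_gen M : (forall i, fin_gen (Psi i)) -> filt M -> fin_gen M.
Proof.
move=> fgP; elim=> [N /fin_gen0 //|N {}M j f g _ _ fgN fg].
exact: fin_gen_ext fg fgN (fgP j).
Qed.

Lemma filt_filtered M :
  (forall i, fin_gen (Psi i)) -> filt M -> filtered P Psi M.
Proof.
move=> fgP fM; split; first exact: filt_fin_gen.
elim: fM => [N N0|N {}M j f g Pj _ [s [F [F0 Fs FS]]] [fI fg gS]].
  exists 0%N, (fun=> fullmod N) => //; split=> // x.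
    by rewrite (N0 x) rpred0.
  by rewrite (N0 x) rpred0.
(* The filtration of [N] is pushed into [M] along [f], and [M] itself is put on top as term
   [s.+1]. *)
pose F' k : submodClosed M :=
  if (k <= s)%N then (immod f (F k) : submodClosed M)
  else fullmod M.
have F'E k : (k <= s)%N -> F' k = immod f (F k) by rewrite /F' => ->.
have F'S : F' s.+1 = fullmod M by rewrite /F' ltnn.
exists s.+1, F'; split.
- move=> x; rewrite F'E //; split=> [/immodP[y /F0 -> <-]|->].
    exact: linear0.
  exact: rpred0.
- by move=> x; rewrite F'S in_fullmod.
(* Top step: [F s] is all of [N], so its image is the kernel of [g] and the factor is [Psi j]. *)
move=> k; rewrite ltnS leq_eqVlt => /predU1P[->|ks].
  rewrite F'E // F'S; split; first by move=> x _; exact: in_fullmod.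
  exists j => //.
  apply: (quotmod_isomorphic
    (g := g \o (val : {linear submodule (fullmod M) -> M}))).
    move=> y; have [x <-] := gS y.
    by exists (Sub x (in_fullmod x)).
  move=> x; rewrite [_ x]/=; split=> [/fg[y yE]|].
    by apply/immodP; exists y.
  by move=> /immodP[y _ yE]; apply/fg; exists y.
have [sub [j' Pj' iso']] := FS k ks.
rewrite (F'E _ (ltnW ks)) (F'E _ ks); split.
  by move=> _ /immodP[x /sub xF <-]; apply/immodP; exists x.
exists j' => //; have [h hB] := iso'.
(* Lower steps: [f] maps [F k.+1] isomorphically onto its image. The inverse [r] matches the image
   of [F k] with [F k], so the factor is unchanged. *)
have fS (w : submodule (immod f (F k.+1))) :
    exists u : submodule (F k.+1), f (val u) = val w.
  by have /immodP[x xF <-] := valP w; exists (Sub x xF).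
have [|r rE] := factor_mono
    (f := f \o (val : {linear submodule (F k.+1) -> N}))
    (h := val : {linear submodule (immod f (F k.+1)) -> M}) _ fS.
  by apply: inj_comp => //; apply: val_inj.
have {}rE w : f (val (r w)) = val w by exact: rE.
apply: isomorphic_trans iso'.
apply: (quotmod_isomorphic (g := quotmod_pi _ \o r)).
  move=> y; have [x <-] := quotmod_pi_surj y.
  have fxF : f (val x) \in immod f (F k.+1).
    by apply/immodP; exists (val x) => //; apply: valP.
  exists (Sub (f (val x)) fxF) => /=; congr quotmod_pi.
  by apply/val_inj/fI; rewrite rE.
move=> x; rewrite [_ x]/= quotmod_pi_eq0.
rewrite [r x \in _]unfold_in [x \in _]unfold_in.
split=> [xF|/immodP[y yF]]; rewrite -?rE.
  by apply/immodP; exists (val (r x)).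
by move=> /fI <-.
Qed.

(** Induction on the filtration of [X]: if [X / X0] is [Psi j], the preimage of [X0] in [M], taken
    as the kernel of [q \o g], is an extension of [X0] by [N], and [M] modulo it is again
    [Psi j]. *)
Lemma filt_ext (N M X : lmodType A) (f : {linear N -> M})
    (g : {linear M -> X}) :
  short_exact f g -> filt N -> filt X -> filt M.
Proof.
move=> fg fN fX.
elim: fX => [X0 X00|X1 X0 j p q Pj _ IH [pI pq qS]] in M f g fg *.
  have [fI fgE _] := fg; apply: filt_iso fN; exists f.
  by apply: inj_surj_bijective fI _ => y; apply/fgE.
have [fI fgE gS] := fg.
have qgS : surjective (q \o g).
  by move=> y; have [x <-] := qS y; have [z <-] := gS x; exists z.
have ex := kermod_short_exact qgS.
have [|k kE] := factor_mono (f := p)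
  (h := g \o (val : {linear submodule (kermod (q \o g)) -> M})) pI.
  by move=> w; apply/pq/eqP/(valP w).
have {}kE w : p (k w) = g (val w) by exact: kE.
have [|f' f'E] := factor_mono
    (f := val : {linear submodule (kermod (q \o g)) -> M}) (h := f) val_inj.
  move=> w; have H : f w \in kermod (q \o g).
    by rewrite unfold_in /= (exact0 fgE) linear0.
  by exists (Sub (f w) H).
apply: (FiltStep
  (f := val : {linear submodule (kermod (q \o g)) -> M}) Pj _ ex).
apply: (IH _ f' k); split.
- by move=> x y E; apply: fI; rewrite -!f'E E.
- move=> y; split=> [ky|[x <-]].
    have [|x xE] := (fgE (val y)).1; first by rewrite -[LHS]kE ky linear0.
    by exists x; apply: val_inj; rewrite f'E.
  by apply: pI; rewrite kE f'E (exact0 fgE) linear0.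
- move=> x; have [z zE] := gS (p x).
  have H : z \in kermod (q \o g) by rewrite unfold_in /= zE (exact0 pq).
  by exists (Sub z H); apply: pI; rewrite kE.
Qed.

End Filt.

Lemma filt_sub (A : pzRingType) (I : Type) (P1 P2 : pred I)
    (Psi : I -> lmodType A) M :
  subpred P1 P2 -> filt P1 Psi M -> filt P2 Psi M.
Proof.
move=> sP; elim=> [N N0|N {}M j f g Pj _ IH fg]; first exact: FiltZero.
exact: FiltStep (sP j Pj) IH fg.
Qed.

(** * Vanishing of Ext^1 as a lifting property *)

Section Lifting.
Variable A : pzRingType.
Implicit Types N U V W X Y : lmodType A.

(* A form of [Ext^1(X, N) = 0]. *)
Definition lifts X N : Prop :=
  forall V W (f : {linear N -> V}) (g : {linear V -> W}),
    short_exact f g -> Hom_surjective X g.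

(** The pullback of the given sequence along [h] is an extension of [X] by [Y], hence splits; a
    section of it followed by the projection to [V] lifts [h]. *)
Lemma lifts_Ext1 X Y : Ext1_zero X Y -> lifts X Y.
Proof.
move=> ext0 V W f g [fI fg gS] h.
(* The kernel of [d] is the pullback of [h] and [g]. *)
have [|d dE] := @linear_exists A (X * V)%type W (fun z => h z.1 - g z.2).
  by move=> a u v; rewrite /= !linearP scalerDr addrACA.
have dE0 z : z \in kermod d <-> h z.1 = g z.2.
  by rewrite unfold_in dE subr_eq0; split=> /eqP.
have [|i iE] := @linear_exists A Y (X * V)%type (fun y => (0, f y)).
  by move=> a u v; rewrite linearP; congr pair; rewrite /= scaler0 addr0.
have [|j jE] := factor_mono
    (f := val : {linear submodule (kermod d) -> _}) (h := i) val_inj.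
  move=> y; have H : i y \in kermod d.
    by apply/dE0; rewrite iE /= linear0 (exact0 fg).
  by exists (Sub (i y) H).
pose p : {linear submodule (kermod d) -> X} :=
  fst \o (val : {linear submodule (kermod d) -> (X * V)%type}).
have p1 z : p z = (val z).1 by [].
have pE : short_exact j p.
  split.
  - by move=> y y' E; apply: fI; have := iE y; rewrite -jE E jE iE => -[].
  - move=> z; split=> [z0|[y <-]]; last by rewrite p1 jE iE.
    have := (dE0 (val z)).1 (valP z); rewrite -p1 z0 linear0.
    move=> /esym/fg[y yE]; exists y; apply: val_inj; rewrite jE iE yE -z0.
    by rewrite -surjective_pairing.
  - move=> x; have [v vE] := gS (h x).
    by exists (Sub (x, v) ((dE0 (x, v)).2 (esym vE))).
have [phi [phiB _ phi2]] := ext0 (Extension pE).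
(* The evident section [x0] of the split extension, carried back through [phi], becomes a section
   [k] of [p]. *)
have [|x0 x0E] := @linear_exists A X (Y * X)%type (fun x => (0, x)).
  by move=> a u v; congr pair; rewrite /= scaler0 addr0.
have [k kE] := factor_mono (h := x0) (bij_inj phiB)
  (fun x => bijective_surjective phiB (x0 x)).
exists (snd \o (val : {linear submodule (kermod d) -> (X * V)%type}) \o k) => x.
rewrite /= -((dE0 _).1 (valP (k x))); congr (h _).
by rewrite -[LHS]/(p (k x)) -[LHS]phi2 kE x0E.
Qed.

(** Devissage: with [S] the image of [N1] in [V], the quotient [V / S] is an extension of [W] by
    [Psi j], and [V] one of [V / S] by [N1]. So [h] lifts first to [V / S], then to [V]. *)
Lemma lifts_filt (I : Type) (P : pred I) (Psi : I -> lmodType A) X N :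
  (forall j, P j -> lifts X (Psi j)) -> filt P Psi N -> lifts X N.
Proof.
move=> Xj; elim=> {N} [N N0|N1 N j f1 g1 Pj _ IH [fI1 fg1 gS1]] V W f g.
  move=> [fI fg gS] h.
  have gB : bijective g.
    apply: inj_surj_bijective => //; apply: linear_inj0 => v /fg[n <-].
    by rewrite (N0 n) linear0.
  exact: factor_mono (bij_inj gB) (fun w => bijective_surjective gB (h w)).
move=> [fI fg gS] h.
pose S := immod (f \o f1) (fullmod N1).
have SE v : v \in S <-> exists n, f (f1 n) = v.
  split=> [/immodP[n _ <-]|[n <-]]; first by exists n.
  by apply/immodP; exists n => //; apply: in_fullmod.
have [|gq gqE] := factor_epi (h := g) (quotmod_pi_surj (S := S)).
  by move=> v /quotmod_pi_eq0/SE[n <-]; apply: exact0.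
have [|fq fqE] := factor_epi (h := quotmod_pi S \o f) gS1.
  by move=> n /fg1[m <-]; apply/quotmod_pi_eq0/SE; exists m.
have [|h1 h1E] := Xj j Pj _ _ fq gq _ h.
  split.
  - apply: linear_inj0 => y; have [n <-] := gS1 y.
    rewrite fqE => /quotmod_pi_eq0/SE[m /fI <-]; exact: exact0.
  - move=> y; split=> [|[z <-]].
      have [v <-] := quotmod_pi_surj y; rewrite gqE => /fg[n <-].
      by exists (g1 n); rewrite fqE.
    by have [n <-] := gS1 z; rewrite fqE gqE; apply: exact0.
  - by move=> w; have [v <-] := gS w; exists (quotmod_pi S v); rewrite gqE.
have [|h2 h2E] := IH _ _ (f \o f1) (quotmod_pi S) _ h1.
  split; [exact: inj_comp | | exact: quotmod_pi_surj].
  by move=> v; rewrite quotmod_pi_eq0 SE.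
by exists h2 => x; rewrite -gqE h2E.
Qed.

End Lifting.

(** * Finite direct sums and add(D) *)

Section DirectSums.
Variables (A : pzRingType).
Implicit Types U V W X D : lmodType A.

Section Components.
Variables (I : finType) (M : I -> lmodType A).

Definition dsum_proj i (z : dsum M) : M i := z i.
Lemma dsum_proj_linear i : linear (dsum_proj i).
Proof. by move=> a u v; rewrite /dsum_proj !ffunE. Qed.
HB.instance Definition _ i :=
  GRing.isLinear.Build A (dsum M) (M i) _ (dsum_proj i) (dsum_proj_linear i).

Definition dsum_inj i (x : M i) : dsum M :=
  [ffun j => dfwith (fun k => 0 : M k) x j].
Lemma dsum_inj_linear i : linear (@dsum_inj i).
Proof.
move=> a u v; apply/ffunP => j; rewrite !ffunE.
have [->|ij] := eqVneq j i; first by rewrite !dfwith_in.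
by rewrite !dfwith_out 1?eq_sym // scaler0 addr0.
Qed.
HB.instance Definition _ i :=
  GRing.isLinear.Build A (M i) (dsum M) _ (@dsum_inj i) (@dsum_inj_linear i).

Lemma dsum_injK i : cancel (@dsum_inj i) (dsum_proj i).
Proof. by move=> x; rewrite /dsum_proj ffunE dfwith_in. Qed.

Lemma dsum_decomp (z : dsum M) : z = \sum_i dsum_inj (z i).
Proof.
apply/ffunP => j; rewrite -[RHS]/(dsum_proj j _) linear_sum (bigD1 j) //=.
rewrite dsum_injK big1 ?addr0 // => i ij.
by rewrite /dsum_proj ffunE dfwith_out.
Qed.

Lemma lifts_dsum N : (forall i, lifts (M i) N) -> lifts (dsum M) N.
Proof.
move=> MN V W f g fg h.
have [k kE] := fin_all_exists (fun i => MN i _ _ _ _ fg (h \o @dsum_inj i)).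
have [|l lE] := @linear_exists A (dsum M) V (fun z => \sum_i k i (z i)).
  move=> a u v; rewrite scaler_sumr -big_split; apply: eq_bigr => i _ /=.
  by rewrite !ffunE linearP.
exists l => z; rewrite lE linear_sum [in RHS](dsum_decomp z) linear_sum.
by apply: eq_bigr => i _; rewrite kE.
Qed.

End Components.

(** The complement is the kernel of [p], through [x = s (p x) + (x - s (p x))]. *)
Lemma split_direct_summand U D (s : {linear U -> D}) (p : {linear D -> U}) :
  cancel s p -> direct_summand U D.
Proof.
move=> sK; exists (submodule (kermod p)); apply: isomorphic_sym.
have [|h hE] := @linear_exists A (U * submodule (kermod p))%type D
  (fun z => s z.1 + val z.2).
  by move=> a u v; rewrite /= !linearP scalerDr addrACA.
exists h; apply: inj_surj_bijective.
  apply: linear_inj0 => -[u w]; rewrite hE /= => E.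
  have u0 : u = 0.
    have /eqP w0 := valP w; move/(congr1 p): E.
    by rewrite linearD sK w0 addr0 linear0.
  by move: E; rewrite u0 linear0 add0r => w0; congr pair; apply: val_inj.
move=> x; have H : x - s (p x) \in kermod p.
  by rewrite unfold_in linearB sK subrr.
by exists (p x, Sub (x - s (p x)) H); rewrite hE /= addrC subrK.
Qed.

Lemma dsum_direct_summand (I : finType) (M : I -> lmodType A) i :
  direct_summand (M i) (dsum M).
Proof. exact: split_direct_summand (@dsum_injK _ M i). Qed.

Lemma dsum_reindex (I J : finType) (M : I -> lmodType A) (e : J -> I) :
  bijective e -> isomorphic (dsum M) (dsum (fun j => M (e j))).
Proof.
case=> e' eK e'K.
have [|h hE] := @linear_exists A (dsum M) (dsum (fun j => M (e j)))
  (fun z => [ffun j => z (e j)]).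
  by move=> a u v; apply/ffunP => j; rewrite !ffunE.
exists h; apply: inj_surj_bijective.
  apply: linear_inj0 => z; rewrite hE => z0; apply/ffunP => i.
  by have /ffunP/(_ (e' i)) := z0; rewrite !ffunE e'K.
(* [e (e' i)] and [i] are only propositionally equal, so the preimage needs a cast; uniqueness of
   equality proofs on a finite type removes it afterwards. *)
move=> y; exists [ffun i => ecast i (M i) (e'K i) (y (e' i))]; rewrite hE.
apply/ffunP => j; rewrite !ffunE.
have cE j' (E : e j' = e j) : ecast i (M i) E (y j') = y j.
  have jj := can_inj eK E; move: E; rewrite jj => E.
  by rewrite (eq_irrelevance E erefl).
exact: cE.
Qed.

(** Enumeration frees the summands from ordinal indices, so that [void] and [option] can serve as
    index types. *)
Lemma in_add_fin D X (I : finType) (Y : I -> lmodType A) :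
  fin_gen X -> (forall k, direct_summand (Y k) D) -> isomorphic X (dsum Y) ->
  in_add D X.
Proof.
move=> Xfg YD XY; split=> //.
exists #|I|, (fun k => Y (enum_val k)); split=> //.
apply: isomorphic_trans XY _.
exact/dsum_reindex/enum_val_bij.
Qed.

Lemma in_add0 D X : zero_module X -> in_add D X.
Proof.
move=> X0; apply: (in_add_fin (I := void) (Y := fun=> X)) => //.
  exact: fin_gen0.
exists \0; apply: inj_surj_bijective => [x y _|y].
  by rewrite (X0 x) (X0 y).
by exists 0; apply/ffunP => -[].
Qed.

(** Indexing by [option 'I_n] makes room for one more summand: [None] carries [U]. *)
Lemma in_add_prod D X U :
  fin_gen (X * U)%type -> in_add D X -> direct_summand U D ->
  in_add D (X * U)%type.
Proof.
move=> XUfg [_ [n [Y [YD XY]]]] UD.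
apply: (in_add_fin (Y := oapp Y U)) => // [[]//|].
apply: isomorphic_trans (isomorphic_prod _ XY) _.
have [|h hE] := @linear_exists A (dsum Y * U)%type (dsum (oapp Y U))
  (fun z => [ffun o => match o return oapp Y U o with
                       | Some i => z.1 i | None => z.2 end]).
  by move=> a u v; apply/ffunP => -[i|]; rewrite !ffunE.
exists h; apply: inj_surj_bijective.
  apply: linear_inj0 => -[y u]; rewrite hE => /ffunP E; congr pair.
    by apply/ffunP => i; have := E (Some i); rewrite !ffunE.
  by have := E None; rewrite !ffunE.
move=> z; exists ([ffun i => z (Some i)], z None); rewrite hE.
by apply/ffunP => -[i|]; rewrite !ffunE.
Qed.

End DirectSums.

(** * Covers of filtered modules by sums of the [Q j] *)

Section Covers.
Variables (A : pzRingType) (t : nat) (Psi Q : 'I_t -> lmodType A).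
Variables (le : rel 'I_t) (pcs : proper_costratifying_system Psi Q le).
Variables (P : pred 'I_t) (P_down : forall j k, P j -> le k j -> P k).

Lemma pcs_lifts i N : filt P Psi N -> lifts (Q i) N.
Proof. by apply: lifts_filt => j _; apply/lifts_Ext1/(pcs_Ext pcs). Qed.

(** [P] and [D] are kept general to serve twice: for the indices below some [i] with the matching
    partial sum, and for all indices with [dsum Q]. *)
Lemma filt_cover (D M : lmodType A) :
  (forall j, P j -> direct_summand (Q j) D) -> filt P Psi M ->
  exists (M' Q' : lmodType A) (f : {linear M' -> Q'}) (g : {linear Q' -> M}),
    [/\ short_exact f g, filt P Psi M', filt P Psi Q' & in_add D Q'].
Proof.
move=> QD; elim=> {M} [M M0|N M j i p Pj fN IH [iI ip pS]].
  exists M, M, idfun, \0.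
  split; [|exact: FiltZero|exact: FiltZero|exact: in_add0].
  split=> // [y|y]; last by exists 0; rewrite (M0 y).
  by split=> // _; exists y.
have [N' [QN [f [g [[fI fg gS] fN' fQN addQN]]]]] := IH.
have [Z [a [beta [[aI ab bS] /filtered_filt fZ]]]] := pcs_seq pcs j.
(* The factors of [Z] are [Psi k] with [k] below [j]; down-closure puts these [k] in [P]. *)
have {}fZ : filt P Psi Z by apply: filt_sub fZ => k; apply: P_down.
have fQj : filt P Psi (Q j) := FiltStep Pj fZ (And3 aI ab bS).
have [b bE] := pcs_lifts fN (And3 iI ip pS) beta.
have fQ' : filt P Psi (QN * Q j)%type.
  exact: filt_ext (split_exact _ _) fQN fQj.
have [|c cE] := @linear_exists A (QN * Q j)%type M (fun z => i (g z.1) + b z.2).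
  by move=> r u v; rewrite /= !linearP scalerDr addrACA.
have pc z : p (c z) = beta z.2.
  by rewrite cE linearD (exact0 ip) add0r bE.
have cS : surjective c.
  move=> m; have [y yE] := bS (p m).
  have [|n nE] := (ip (m - b y)).1.
    by apply/eqP; rewrite linearB bE yE subrr.
  by have [x xE] := gS n; exists (x, y); rewrite cE /= xE nE subrK.
exists (submodule (kermod c)), (QN * Q j)%type, val, c; split=> //.
- exact: kermod_short_exact.
(* The kernel of [c] is an extension of [Z] by [N']: by [pc], second coordinates lie in the kernel
   of [beta], which gives [q]; the inclusion [r] sends [w] to [(f w, 0)]. *)
- have [|q qE] := factor_mono (f := a)
      (h := snd \o (val : {linear submodule (kermod c) -> (QN * Q j)%type})) aI.
    by move=> w; apply/ab; rewrite -[_ w]/(val w).2 -pc (eqP (valP w)) linear0.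
  have [|r rE] := factor_mono
      (f := val : {linear submodule (kermod c) -> (QN * Q j)%type})
      (h := @split_inj A (Q j) QN \o f) val_inj.
    move=> w; have H : split_inj (Q j) (f w) \in kermod c.
      by rewrite unfold_in cE /= (exact0 fg) !linear0 addr0.
    by exists (Sub (split_inj (Q j) (f w)) H).
  have {}qE w : a (q w) = (val w).2 by exact: qE.
  have {}rE w : val (r w) = (f w, 0) by exact: rE.
  apply: (filt_ext (f := r) (g := q) _ fN' fZ); split.
  + by move=> x y E; apply: fI; have := rE x; rewrite E rE => -[->].
  + move=> w; split=> [w0|[x <-]]; last first.
      by apply: aI; rewrite qE rE linear0.
    have w2 : (val w).2 = 0 by rewrite -[LHS]qE w0 linear0.
    have /eqP := valP w; rewrite cE w2 linear0 addr0 => E.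
    have [|x xE] := (fg (val w).1).1; first by apply: iI; rewrite E linear0.
    by exists x; apply: val_inj; rewrite rE xE -w2 -surjective_pairing.
  (* [b (a z)] is killed by [p], so it comes from [N]; a first coordinate [x] with
     [i (g x) = - b (a z)] cancels it. *)
  + move=> z; have [|n nE] := (ip (- b (a z))).1.
      by rewrite linearN bE (exact0 ab) oppr0.
    have [x xE] := gS n.
    have H : (x, a z) \in kermod c by rewrite unfold_in cE /= xE nE addNr.
    by exists (Sub (x, a z) H); apply: aI; rewrite qE.
- apply: in_add_prod addQN (QD j Pj).
  exact: filt_fin_gen (pcs_Psi_fg pcs) fQ'.
Qed.

End Covers.

(** * Splicing covers into resolutions *)

Section Resolutions.
Variables (A : pzRingType) (D M Q0 : lmodType A) (g : {linear Q0 -> M}).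
Hypotheses (M_fg : fin_gen M) (addQ0 : in_add D Q0).
Hypotheses (gS : surjective g) (gD : Hom_surjective D g).

(** Only degree 0 and the augmentation are constrained here; the other terms and the zero
    differentials are fillers. *)
Lemma in_C0 : in_C D 0 M.
Proof. by split=> //; exists (fun=> Q0), (fun=> \0), g; split. Qed.

(** Yoneda splice: the resolution of [M'] is shifted by one degree, [Q0] enters in degree 0, and
    [f \o eps] is the new first differential. *)
Lemma in_CS m (M' : lmodType A) (f : {linear M' -> Q0}) :
  short_exact f g -> in_C D m M' -> in_C D m.+1 M.
Proof.
move=> [fI fg _] [_ [N [d [eps [addN [epsS epsD] d0 dS]]]]].
split=> //; pose N' k := if k is k'.+1 then N k' else Q0.
pose d' k : {linear N' k.+1 -> N' k} :=
  match k return {linear N' k.+1 -> N' k} with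
  | 0 => f \o eps | k'.+1 => d k' end.
exists N', d', g; split=> // [[|k] //|_|[|k]].
- exact: addN.
(* Exactness at [Q0]: a map from [D] killed by [g] factors through [f], and the factor lifts along
   [eps] by [epsD]. *)
- split=> [y|h].
    rewrite fg; split=> [[x <-]|[x <-]]; last by exists (eps x).
    by have [z <-] := epsS x; exists z.
  split=> [gh|[h' h'E] x]; last by rewrite -h'E; exact: (exact0 fg (eps _)).
  have [k kE] := factor_mono fI (fun w => (fg (h w)).1 (gh w)).
  have [l lE] := epsD k; exists l => x.
  by rewrite /= lE kE.
(* Exactness in degree 1: [f] is injective, so [f \o eps] has the same kernel as [eps]. *)
- rewrite ltnS => m0; have [ex exD] := d0 m0; split=> [y|h].
    rewrite -ex; split=> [E|E]; last by rewrite /= E linear0.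
    by apply: fI; rewrite linear0.
  rewrite -exD; split=> /= E x; last by rewrite E linear0.
  by apply: fI; rewrite E linear0.
- exact: dS.
Qed.

End Resolutions.

(** The kernel of a cover is again filtered, so the induction on [m] runs over all [M] at once,
    starting from a single cover at [m = 0]. *)
Lemma filt_in_C (A : pzRingType) (t : nat) (Psi Q : 'I_t -> lmodType A)
    (le : rel 'I_t) (pcs : proper_costratifying_system Psi Q le) m M :
  filt xpredT Psi M -> in_C (dsum Q) m M.
Proof.
elim: m M => [|m IH] M fM; have [|j _|M' [Q' [f [g [fg fM' _ addQ']]]]] :=
  filt_cover (D := dsum Q) pcs _ _ fM; rewrite //.
- exact: dsum_direct_summand.
- have gD : Hom_surjective (dsum Q) g.
    by apply: (lifts_dsum _ fg) => i; apply: (pcs_lifts pcs fM').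
  have [_ _ gS] := fg.
  exact: in_C0 (filt_fin_gen (pcs_Psi_fg pcs) fM) addQ' gS gD.
- exact: dsum_direct_summand.
- have gD : Hom_surjective (dsum Q) g.
    by apply: (lifts_dsum _ fg) => i; apply: (pcs_lifts pcs fM').
  have [_ _ gS] := fg.
  apply: (in_CS (filt_fin_gen (pcs_Psi_fg pcs) fM) addQ' gS gD fg).
  exact: IH.
Qed.

Theorem proposition4p1 (R : comPzRingType) (L : algType R)
    (artinL : artin_algebra L)
    (t : nat) (Psi Q : 'I_t -> lmodType L) (le : rel 'I_t)
    (pcs : proper_costratifying_system Psi Q le) :
  (forall (i : 'I_t) (M : lmodType L),
     filtered (fun j => le j i) Psi M ->
     exists (M' Q' : lmodType L) (f : {linear M' -> Q'}) (g : {linear Q' -> M}),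
       [/\ short_exact f g,
           filtered (fun j => le j i) Psi M',
           filtered (fun j => le j i) Psi Q'
         & in_add (dsum (fun j : {j : 'I_t | le j i} => Q (val j))) Q'])
  /\
  (forall (m : nat) (M : lmodType L),
     (1 <= m)%N -> filtered xpredT Psi M -> in_C (dsum Q) m M).
Proof.
(* Kept in the context for the final step, where [filt_filtered] requires it. *)
have fgP := pcs_Psi_fg pcs.
split=> [i M /filtered_filt fM|m M _ /filtered_filt]; last first.
  exact: (filt_in_C pcs).
have [_ _ le_trans _] := pcs_order pcs.
have [|j ji|M' [Q' [f [g [fg fM' fQ' addQ']]]]] := filt_cover
  (D := dsum (fun j : {j : 'I_t | le j i} => Q (val j))) pcs _ _ fM.
- by move=> j k ji kj; apply: le_trans kj ji.
- exact: (dsum_direct_summand (fun j : {j : 'I_t | le j i} => Q (val j))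
    (Sub j ji)).
by exists M', Q', f, g; split=> //; apply: filt_filtered.
Qed.
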